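(* Let $G$ be a finite group and let $\pi(G)=\{p_1,p_2,\ldots,p_k\}$, where $k\geq 2$ and $p_1<p_2<\cdots<p_k$. If $G$ has a normal Hall $\{p_2,p_3,\ldots,p_k\}$-subgroup, then $G$ is not a $\mathcal{B}_{\psi}$-group.
   Context: For a finite group $H$, let $\psi(H)=\sum_{x\in H}o(x)$ be the sum of the orders of all elements of $H$, where $o(x)$ is the order of $x$. A finite group $G$ is called a $\mathcal{B}_{\psi}$-group if $\psi(H)<|G|$ for every proper subgroup $H$ of $G$. $\pi(G)$ denotes the set of prime divisors of $|G|$. For a set $\pi$ of primes, a subgroup $H$ of a finite group $G$ is a Hall $\pi$-subgroup of $G$ if $\pi(H)\subseteq\pi$ and no prime divisor of the index $[G:H]$ lies in $\pi$. *)

(* Defs.v *)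
From mathcomp Require Import all_boot all_order all_algebra all_fingroup all_solvable.

Set Implicit Arguments.
Unset Strict Implicit.
Unset Printing Implicit Defensive.

Import GroupScope.

Definition psi (gT : finGroupType) (H : {set gT}) : nat := (\sum_(x in H) #[x])%N.

Definition Bpsi_group (gT : finGroupType) (G : {group gT}) : Prop :=
  forall H : {group gT}, H \proper G -> (psi H < #|G|)%N.

(* Main.v *)
(* Let p be the smallest prime divisor of |G|. A normal subgroup N as in the
   statement lies in a subgroup M of index p. Every nontrivial element of M has
   order at least p, and those in N have order at least p + 1, so
   psi(M) >= 1 + p (|M| - 1) + (|N| - 1) = |G| + (|N| - p) >= |G|. *)
Require Import Defs.
From mathcomp Require Import all_boot all_order all_algebra all_fingroup all_solvable.

Set Implicit Arguments.
Unset Strict Implicit.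
Unset Printing Implicit Defensive.

Import GroupScope.

(** The least prime divisor of [#[x]] divides [#|A|]. Taking [m] to be [p] or [p.+1] serves both the
    weak and the strict bounds below. *)
Lemma order_ge_prime_bound (gT : finGroupType) (A : {group gT}) (m : nat) (x : gT) :
  {in \pi(A), forall q, m <= q} -> x \in A -> x != 1 -> m <= #[x].
Proof.
move=> Am Ax x1; have x_gt1: 1 < #[x] by rewrite order_gt1.
apply: leq_trans (pdiv_leq (order_gt0 x)); apply: Am.
by rewrite mem_primes pdiv_prime // cardG_gt0 (dvdn_trans (pdiv_dvd _)) ?order_dvdG.
Qed.

(* Stated additively to avoid truncated subtraction. *)
Lemma psi_lower_bound (gT : finGroupType) (M N : {group gT}) (p : nat) :
    {in \pi(M), forall q, p <= q} -> N \subset M ->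
    {in \pi(N), forall q, p < q} ->
  #|M| * p + #|N| <= psi M + p.
Proof.
move=> Mp sNM Np; rewrite /psi -!sum1_card big_distrl /=.
(* The identity contributes [p + 1] on the left and [1] on the right, so the extra [p] on the right
   balances it exactly. *)
rewrite (big_setD1 1) //= (big_setD1 1 (group1 N)) /= [X in _ <= X + _](big_setD1 1) //=.
rewrite order1 mul1n addnACA [p + 1]addnC addnAC leq_add2r leq_add2l.
have defN: M^# :&: N = N^# by rewrite setIDAC (setIidPr sNM).
rewrite (big_setID N) [X in _ <= X](big_setID N) /= defN.
(* Regrouped so that each element of [N^#] must pay [p + 1] and each element of [M] outside [N] only
   [p]. *)
rewrite addnAC; apply: leq_add; last first.
  apply: leq_sum => x; rewrite !inE => /and3P[_ x1 Mx].
  exact: order_ge_prime_bound Mp Mx x1.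
rewrite -big_split /=; apply: leq_sum => x.
rewrite !inE addn1 => /andP[x1 Nx].
exact: order_ge_prime_bound Np Nx x1.
Qed.

(** A Sylow [p]-subgroup has a subgroup [Q] of index [p]. Since [N] is normal of order prime to [p],
    [N <*> Q] has order [#|N| * #|Q|]. *)
Lemma normal_pcompl_sub_index (gT : finGroupType) (G N : {group gT}) (p : nat) :
    p \in \pi(G) -> N <| G -> p^'.-Hall(G) N ->
  exists M : {group gT}, [/\ N \subset M, M \subset G & (#|M| * p = #|G|)%N].
Proof.
move=> piGp nsNG hallN; have [P sylP] := Sylow_exists p G.
have sPG := pHall_sub sylP; have pP := pHall_pgroup sylP.
have p_pr: prime p by move: piGp; rewrite mem_primes => /andP[].
(* Positivity makes the predecessor taken below a genuine decrement of the exponent. *)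
have logG: 0 < logn p #|G| by rewrite logn_gt0.
have [|Q [sQP _ cardQ]] := @normal_pgroup p _ (logn p #|G|).-1 P P pP (normal_refl P).
  by rewrite (card_Hall sylP) p_part pfactorK ?leq_pred.
have pQ := pgroupS sQP pP.
have sQG := subset_trans sQP sPG.
exists (N <*> Q)%G; split; first exact: joing_subl.
  by rewrite join_subG (normal_sub nsNG).
rewrite /= norm_joinEr ?(subset_trans sQG (normal_norm nsNG)) //.
rewrite TI_cardMg; last first.
  by rewrite setIC; apply: coprime_TIg; apply: pnat_coprime pQ (pHall_pgroup hallN).
by rewrite cardQ (card_Hall hallN) -mulnA -expnSr prednK // -p_part mulnC partnC.
Qed.

Theorem proposition2p4 (gT : finGroupType) (G : {group gT})
  (k : nat) (p : k.-tuple nat)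
  (hk : (2 <= k)%N)
  (hinc : sorted ltn p)
  (hpi : \pi(G) =i p)
  (hN : exists N : {group gT},
      N <| G /\ [pred q in behead p].-Hall(G) N) :
  ~ Bpsi_group G.
Proof.
case: hN => N [nsNG hallN] B.
have sz: 2 <= size p by rewrite size_tuple.
have {hpi}: \pi(G) =i tval p := hpi.
move: (tval p) sz hinc hallN => [|p1 [|p2 s]] //= _ hinc hallN hpi.
set t := p2 :: s in hpi hallN.
have lt_t q: q \in t -> p1 < q.
  exact: (allP (order_path_min (s := t) ltn_trans hinc) q).
have piGp1: p1 \in \pi(G) by rewrite hpi mem_head.
have p1_pr: prime p1 by move: piGp1; rewrite mem_primes => /andP[].
have piN q: q \in \pi(N) -> p1 < q.
  by move=> /(pnatPpi (pHall_pgroup hallN)) /lt_t.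
(* Only primes in [\pi(G)] matter, and among them those in [t] are exactly those other than [p1]. *)
have hallN': p1^'.-Hall(G) N.
  rewrite (eq_in_pHall (rho := [pred q in t])) // => q piGq; rewrite !inE.
  move: piGq; rewrite hpi inE => /predU1P[->|tq].
    rewrite eqxx; apply/esym/negbTE/negP=> /lt_t; by rewrite ltnn.
  by rewrite gtn_eqF ?lt_t //; exact: esym.
have [M [sNM sMG cardM]] := normal_pcompl_sub_index piGp1 nsNG hallN'.
(* Here [k >= 2] enters: [p2] divides [#|N|] and exceeds [p1]. *)
have lep1N: p1 <= #|N|.
  have piGp2: p2 \in \pi(G) by rewrite hpi !inE eqxx orbT.
  have piNp2: p2 \in \pi(N).
    by rewrite /= (card_Hall hallN) pi_of_part // inE /= piGp2 mem_head.
  apply: leq_trans (ltnW (piN _ piNp2)) (dvdn_leq (cardG_gt0 N) _).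
  by move: piNp2; rewrite mem_primes => /and3P[].
have /B: M \proper G.
  by rewrite properEcard sMG -cardM -{1}[#|M|]muln1 ltn_pmul2l ?cardG_gt0 ?prime_gt1.
apply/negP; rewrite -leqNgt -cardM -(leq_add2r p1).
apply: leq_trans (psi_lower_bound _ sNM piN); first by rewrite leq_add2l.
move=> q /(piSg sMG); rewrite hpi inE => /predU1P[-> // | /lt_t]; exact: ltnW.
Qed.
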